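(* Let $\Omega\subset\mathbb{R}^3$ be a nonempty bounded open domain, $G>0$, $\mu\in L^1(\Omega)$ with $\mu\ge 0$, and $M=\int_\Omega\mu(x)\,dx>0$. Let $u_0\notin\overline{\Omega}$ and $v_0\in\mathbb{R}^3$ be such that $$\|v_0\|^2<2\int_\Omega\frac{G\mu(x)}{\|u_0-x\|}\,dx.$$ Let $u:[0,T_{max})\to\mathbb{R}^3\setminus\overline{\Omega}$ be the maximal solution in $\mathbb{R}^3\setminus\overline{\Omega}$ of $$u''=-\int_\Omega\frac{G\mu(x)(u-x)}{\|u-x\|^3}\,dx,\qquad u(0)=u_0,\ u'(0)=v_0.$$ Then $u$ is bounded on $[0,T_{max})$ and more precisely $$\forall t\in[0,T_{max}),\quad \mathrm{dist}(u(t),\overline{\Omega})\le\frac{2GM}{\int_\Omega\frac{2G\mu(x)}{\|u_0-x\|}\,dx-\|v_0\|^2}.$$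
   Context: $\|\cdot\|$ is the Euclidean norm on $\mathbb{R}^3$ and $\mathrm{dist}(u,\overline{\Omega})=\min_{x\in\overline{\Omega}}\|u-x\|$. $\mu$ is the local density of a mass $M$ filling $\Omega$, and $G$ is the gravitational constant. The equation of motion is valid only for positions outside $\overline{\Omega}$; $T_{max}\in(0,\infty]$ is the maximal time of existence of the $C^2$ solution with values in $\mathbb{R}^3\setminus\overline{\Omega}$. *)

(* Defs.v *)
From HB Require Import structures.
From mathcomp Require Import all_boot all_order all_algebra.
From mathcomp Require Import all_classical all_reals all_analysis.

Set Implicit Arguments.
Unset Strict Implicit.
Unset Printing Implicit Defensive.

Import Order.TTheory GRing.Theory Num.Theory.
Import numFieldNormedType.Exports.

Local Open Scope classical_set_scope.
Local Open Scope ring_scope.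

(* R^3 is R * R * R, with the library's product topology, module and Borel
   sigma-algebra. The library's norm `|x| on this type is the sup norm; it is
   used only through the topology and boundedness, which do not depend on the
   choice of a norm. Lengths are measured with norm3. *)
Notation space3 R := (R * R * R)%type.

Definition norm3 (R : realType) (x : space3 R) : R :=
  Num.sqrt (x.1.1 ^+ 2 + x.1.2 ^+ 2 + x.2 ^+ 2).

(* The infimum is attained when A is closed and nonempty. *)
Definition dist3 (R : realType) (x : space3 R) (A : set (space3 R)) : R :=
  inf [set norm3 (x - y) | y in A].

Notation leb3 R :=
  ((@lebesgue_measure R \x @lebesgue_measure R) \x @lebesgue_measure R)%E.

Definition vintegral (R : realType) (D : set (space3 R))
    (f : space3 R -> space3 R) : space3 R :=
  (\int[leb3 R]_(x in D) (f x).1.1,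
   \int[leb3 R]_(x in D) (f x).1.2,
   \int[leb3 R]_(x in D) (f x).2).

Definition gravity (R : realType) (G : R) (Omega : set (space3 R))
    (mu : space3 R -> R) (p : space3 R) : space3 R :=
  - vintegral Omega
      (fun x => (G * mu x / norm3 (p - x) ^+ 3) *: (p - x)).

Definition time_interval (R : realType) (T : \bar R) : set R :=
  [set t | 0 <= t /\ (t%:E < T)%E].

(* Derivatives are taken within I, hence are one-sided at an endpoint of I
   that belongs to I. *)
Definition is_derivative_on (R : realType) (I : set R)
    (f df : R -> space3 R) : Prop :=
  forall t, I t ->
    (fun s => (s - t)^-1 *: (f s - f t)) @ within I (t^') --> df t.

Definition is_solution (R : realType) (G : R) (Omega : set (space3 R))
    (mu : space3 R -> R) (u0 v0 : space3 R) (T : \bar R) (u : R -> space3 R)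
    : Prop :=
  (0 < T)%E /\
  exists du ddu : R -> space3 R,
    [/\ is_derivative_on (time_interval T) u du,
        is_derivative_on (time_interval T) du ddu,
        {within time_interval T, continuous ddu},
        u 0 = u0 /\ du 0 = v0 &
        forall t, time_interval T t ->
          ~ closure Omega (u t) /\ ddu t = gravity G Omega mu (u t)].

Definition is_maximal_solution (R : realType) (G : R)
    (Omega : set (space3 R)) (mu : space3 R -> R) (u0 v0 : space3 R)
    (T : \bar R) (u : R -> space3 R) : Prop :=
  is_solution G Omega mu u0 v0 T u /\
  forall (T' : \bar R) (w : R -> space3 R),
    is_solution G Omega mu u0 v0 T' w -> (T <= T')%E ->
    (forall t, time_interval T t -> w t = u t) -> T' = T.

(* Main.v *)
Require Import Defs.
From HB Require Import structures.
From mathcomp Require Import all_boot all_order all_algebra.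
From mathcomp Require Import all_classical all_reals all_analysis.
From mathcomp Require Import measurable_realfun ring lra.

Set Implicit Arguments.
Unset Strict Implicit.
Unset Printing Implicit Defensive.

Import Order.TTheory GRing.Theory Num.Theory.
Import numFieldNormedType.Exports.

Local Open Scope classical_set_scope.
Local Open Scope ring_scope.

(** The bound is conservation of energy read backwards.  Write [Phi p] for the
    Newtonian potential, the integral of [G * mu x / norm3 (p - x)] over
    [Omega].  The equation of motion says [u'' = grad Phi (u)], so
    [E = norm3 u' ^+ 2 / 2 - Phi u] keeps its initial value [- D / 2], where
    [D = 2 * Phi u0 - norm3 v0 ^+ 2] is positive by assumption.  As the kinetic
    term is nonnegative, [Phi (u t) >= D / 2] at all times.  On the other hand
    [Phi p <= G * M / dist3 p (closure Omega)], because every [x] in [Omega] is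
    at least that far from [p].  Comparing the two gives the bound on the
    distance, and boundedness follows since [Omega] is bounded.

    The analytic point is the chain rule for [Phi] along [u].  The first order
    Taylor remainder of [fun p => (norm3 p)^-1] between [p] and [p + h] is
    bounded by [norm3 h ^+ 2 / d ^+ 3] as long as both points stay at distance
    at least [d] from the origin ([inv_norm3_taylor]), and this bound
    integrates against [mu] ([potential_taylor]).  Hence the difference
    quotients of the energy tend to [0] at each time ([energy_quotient_cvg0]),
    and the mean value theorem makes the energy constant
    ([zero_quotient_constant]).

    Integrability of the kernels needs their measurability on [Omega], and
    already that of [Omega], for the product sigma-algebra; this comes from
    covering open sets by rational boxes ([open3_measurable]). *)

(** * Borel measurability in space *)

Local Notation borel3 R :=
  (measurableTypeR R * measurableTypeR R * measurableTypeR R)%type.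

Section borel.
Variable R : realType.
Implicit Types (A : set (space3 R)) (p : space3 R).

Lemma rat_near (x e : R) : 0 < e -> exists q : rat, ball (ratr q : R) e x.
Proof.
move=> e0; have /rat_in_itvoo[q] : x - e < x + e by lra.
rewrite in_itv/= => /andP[q1 q2]; exists q.
by rewrite /ball/= ltr_norml; lra.
Qed.

(** The product sigma-algebra contains the open sets because the topology has
    a countable base of cubes with rational centre and rational radius. *)
Lemma open3_measurable A : open A -> @measurable _ (borel3 R) A.
Proof.
move=> oA.
pose box (a b c r : rat) : set (space3 R) :=
  ball (ratr a : R, ratr b : R, ratr c : R) (ratr r : R).
have mbox a b c r : @measurable _ (borel3 R) (box a b c r).
  rewrite (_ : box a b c r = ball (ratr a : R) (ratr r) `*`
    ball (ratr b : R) (ratr r) `*` ball (ratr c : R) (ratr r)); last first.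
    by apply/seteqP; split.
  by do 2?apply: measurableX; apply: open_measurable; exact: ball_open.
pose C (r a b c : rat) :=
  if `[< box a b c r `<=` A >] then box a b c r else set0.
rewrite (_ : A = \bigcup_r \bigcup_a \bigcup_b \bigcup_c C r a b c); last first.
  apply/seteqP; split=> [p Ap|p [r _ [a _ [b _ [c _]]]]]; last first.
    by rewrite /C; case: asboolP => // sub; exact: sub.
  have /nbhs_ballP[e /= e0 pe] : nbhs p A by apply: open_nbhs_nbhs.
  (* With a radius below [e / 2], a cube that contains [p] lies in the ball of
     radius [e] around [p]. *)
  have /rat_in_itvoo[r] : 0 < e / 2 by lra.
  rewrite in_itv/= => /andP[r0 re].
  have [a pa] := rat_near p.1.1 r0.
  have [b pb] := rat_near p.1.2 r0.
  have [c pc] := rat_near p.2 r0.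
  have pbox : box a b c r p by [].
  exists r => //; exists a => //; exists b => //; exists c => //.
  rewrite /C; case: asboolP => // -[] z boxz; apply: pe.
  apply: (@le_ball _ _ _ (ratr r + ratr r)); first lra.
  by apply: ball_triangle boxz; exact: ball_sym.
do 4!(apply: bigcupT_measurable_rat => ?).
by rewrite /C; case: ifP.
Qed.

Lemma continuous_on_open3_measurable A (f : space3 R -> R) : open A ->
  (forall x, A x -> {for x, continuous f}) ->
  @measurable_fun _ _ (borel3 R) R A f.
Proof.
move=> oA cf.
apply: (measurability _ (RGenOpens.measurableE R)) => // _ [_ [a [b ->] <-]].
apply: open3_measurable; rewrite openE => x [Ax fx].
apply: filterI; first exact: open_nbhs_nbhs.
by apply: cf => //; apply: open_nbhs_nbhs; split=> //; exact: interval_open.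
Qed.
End borel.

(** * Euclidean geometry and the Taylor remainder of the Newton kernel *)

Section euclid.
Variable R : realType.
Implicit Types x y z p q : space3 R.

Definition dot3 x y : R := x.1.1 * y.1.1 + x.1.2 * y.1.2 + x.2 * y.2.

Lemma sqr_norm3 x : norm3 x ^+ 2 = dot3 x x.
Proof.
rewrite /norm3 /dot3 sqr_sqrtr ?expr2//.
by rewrite !addr_ge0// sqr_ge0.
Qed.

Lemma norm3_ge0 x : 0 <= norm3 x. Proof. exact: sqrtr_ge0. Qed.

Lemma norm3N x : norm3 (- x) = norm3 x.
Proof. by rewrite /norm3 /= !sqrrN. Qed.

Lemma norm3E x : norm3 x = Num.sqrt (dot3 x x).
Proof. by rewrite -sqr_norm3 sqrtr_sqr ger0_norm// norm3_ge0. Qed.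

Lemma dot3C x y : dot3 x y = dot3 y x.
Proof. by rewrite /dot3; ring. Qed.

Lemma dot3Zr (k : R) x y : dot3 x (k *: y) = k * dot3 x y.
Proof. by rewrite /dot3 /= /GRing.scale/=; ring. Qed.

(** The norm on the left is the sup norm: this lemma transfers neighbourhoods
    and boundedness, which refer to the sup norm, to Euclidean lengths. *)
Lemma normr_le_norm3 x : `|x| <= norm3 x.
Proof.
have le (a c : R) : a ^+ 2 <= c -> `|a| <= Num.sqrt c.
  by move=> ac; rewrite -sqrtr_sqr ler_wsqrtr.
have := (sqr_ge0 x.1.1, sqr_ge0 x.1.2, sqr_ge0 x.2) => -[[x1 x2] x3].
by rewrite prod_normE/= !ge_max /norm3 !le//=; lra.
Qed.

(** Lagrange's identity: the defect of the squared inequality is the squared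
    length of the cross product. *)
Lemma CauchySchwarz3 x y : dot3 x y <= norm3 x * norm3 y.
Proof.
have [d0|d0] := leP (dot3 x y) 0.
  by apply: le_trans d0 _; rewrite mulr_ge0 ?norm3_ge0.
rewrite -(ler_pXn2r (n := 2)) ?nnegrE ?mulr_ge0 ?norm3_ge0 ?(ltW d0)//.
rewrite exprMn !sqr_norm3 -subr_ge0.
pose a := x.1.1 * y.1.2 - x.1.2 * y.1.1.
pose b := x.1.1 * y.2 - x.2 * y.1.1.
pose c := x.1.2 * y.2 - x.2 * y.1.2.
suff -> : dot3 x x * dot3 y y - dot3 x y ^+ 2 = a ^+ 2 + b ^+ 2 + c ^+ 2.
  by rewrite !addr_ge0// sqr_ge0.
by rewrite /a /b /c /dot3; ring.
Qed.

(** The reverse triangle inequality, squared so that it applies directly to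
    the remainder in [inv_norm3_taylor]. *)
Lemma sqr_norm3_dist_le x y : (norm3 x - norm3 y) ^+ 2 <= norm3 (x - y) ^+ 2.
Proof.
rewrite sqrrB !sqr_norm3.
have := CauchySchwarz3 x y; rewrite /dot3 /= => cs.
by rewrite -subr_ge0; nra.
Qed.

(** With [a = norm3 p], [b = norm3 q], [h = norm3 (q - p) ^+ 2] and the inner
    product eliminated through [b ^+ 2 = a ^+ 2 + 2 * dot3 p (q - p) + h], the
    remainder is [((b - a) ^+ 2 * (b + 2 * a) - h * b) / (2 * a ^+ 3 * b)].
    Since [0 <= (b - a) ^+ 2 <= h], its numerator lies between [- h * b] and
    [2 * a * h].  This is quadratic in the displacement, uniformly over all
    points at distance at least [d] from the origin. *)
Lemma inv_norm3_taylor (d : R) p q : 0 < d -> d <= norm3 p -> d <= norm3 q ->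
  `|(norm3 q)^-1 - (norm3 p)^-1 + dot3 p (q - p) / norm3 p ^+ 3|
    <= norm3 (q - p) ^+ 2 / d ^+ 3.
Proof.
move=> d0; have := sqr_norm3_dist_le q p.
have : norm3 q ^+ 2 = norm3 p ^+ 2 + 2 * dot3 p (q - p) + norm3 (q - p) ^+ 2.
  by rewrite !sqr_norm3 /dot3/=; ring.
move: (norm3 p) (norm3 q) (dot3 _ _) (norm3 (q - p) ^+ 2) => a b s h.
move=> bE bah da db.
have a0 : 0 < a by lra.
have b0 : 0 < b by lra.
have -> : s = (b ^+ 2 - a ^+ 2 - h) / 2 by rewrite bE; field.
have h0 : 0 <= h by apply: le_trans bah; exact: sqr_ge0.
have -> : b^-1 - a^-1 + (b ^+ 2 - a ^+ 2 - h) / 2 / a ^+ 3 =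
   ((b - a) ^+ 2 * (b + 2 * a) - h * b) / (2 * a ^+ 3 * b).
  by field; rewrite !gt_eqF.
have hb : 0 < 2 * a ^+ 3 * b by rewrite !mulr_gt0// exprn_gt0.
rewrite ler_norml; apply/andP; split.
  rewrite ler_pdivlMr// mulNr lerNl.
  apply: (@le_trans _ _ (h * b)).
    by rewrite opprB lerBlDr lerDl mulr_ge0 ?sqr_ge0//; lra.
  rewrite -[leRHS]mulrA ler_wpM2l// ler_pdivlMl ?exprn_gt0// (mulrC 2) -mulrA.
  have : d ^+ 3 <= a ^+ 3 by rewrite lerXn2r// nnegrE ltW.
  by nra.
rewrite ler_pdivrMr// (@le_trans _ _ (2 * a * h))//.
  have : 0 <= (h - (b - a) ^+ 2) * (b + 2 * a) by rewrite mulr_ge0; lra.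
  lra.
rewrite mulrC -[leRHS]mulrA ler_wpM2l// ler_pdivlMl ?exprn_gt0//.
rewrite !exprS expr0 mulr1.
have aabd : d * d * d <= a * a * b by rewrite !ler_pM// ?mulr_ge0// ltW.
by nra.
Qed.

End euclid.

Section limits.
Variable R : realType.

Lemma cvg3P (T : Type) (F : set_system T) (FF : Filter F)
    (f : T -> space3 R) (a : space3 R) : f @ F --> a ->
  [/\ (f t).1.1 @[t --> F] --> a.1.1, (f t).1.2 @[t --> F] --> a.1.2
    & (f t).2 @[t --> F] --> a.2].
Proof.
move=> fa.
have f1 : (f t).1 @[t --> F] --> a.1 by apply: cvg_comp fa _; exact: cvg_fst.
split; last by apply: cvg_comp fa _; exact: cvg_snd.
- by apply: cvg_comp f1 _; exact: cvg_fst.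
- by apply: cvg_comp f1 _; exact: cvg_snd.
Qed.

Lemma cvg_dot3 (T : Type) (F : set_system T) (FF : Filter F)
    (f g : T -> space3 R) (a b : space3 R) : f @ F --> a -> g @ F --> b ->
  dot3 (f t) (g t) @[t --> F] --> dot3 a b.
Proof.
move=> /cvg3P[f1 f2 f3] /cvg3P[g1 g2 g3].
by apply: cvgD; [apply: cvgD|]; apply: cvgM.
Qed.

Lemma cvg_norm3 (T : Type) (F : set_system T) (FF : Filter F)
    (f : T -> space3 R) (a : space3 R) : f @ F --> a ->
  norm3 (f t) @[t --> F] --> norm3 a.
Proof.
move=> fa; rewrite norm3E.
rewrite (_ : (fun t => norm3 (f t)) = Num.sqrt \o (fun t => dot3 (f t) (f t))).
  by apply: continuous_cvg; [exact: sqrt_continuous|exact: cvg_dot3].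
by apply/funext => t /=; rewrite norm3E.
Qed.

End limits.

(** * The potential and its gradient *)

Section weighted.
Variable R : realType.
Variables (Omega : set (space3 R)) (mu : space3 R -> R).
Hypothesis Omega_open : open Omega.
Hypothesis mu_int : (leb3 R).-integrable Omega (EFin \o mu).

Let mOmega : @measurable _ (borel3 R) Omega.
Proof. exact: open3_measurable. Qed.

(** The kernels met below are of this kind: they are continuous and bounded on
    [Omega] because the evaluation point is at positive distance from it. *)
Lemma integrable_weight (k : space3 R -> R) (c : R) :
  (forall x, Omega x -> {for x, continuous k}) ->
  (forall x, Omega x -> `|k x| <= c) ->
  (leb3 R).-integrable Omega (EFin \o (fun x => mu x * k x)).
Proof.
move=> ck kc.
have -> : EFin \o (fun x => mu x * k x) = ((EFin \o mu) \* (EFin \o k))%E.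
  by apply/funext => x /=; rewrite EFinM.
apply: integrableMl => //; first exact: continuous_on_open3_measurable.
exists c; split; first exact: num_real.
by move=> r cr x Ox /=; apply: le_trans (kc x Ox) (ltW cr).
Qed.

Lemma Rintegral_weight_le (k : space3 R -> R) (c : R) :
  (forall x, Omega x -> {for x, continuous k}) ->
  (forall x, Omega x -> `|k x| <= c) ->
  `|\int[leb3 R]_(x in Omega) (mu x * k x)| <=
    c * \int[leb3 R]_(x in Omega) `|mu x|.
Proof.
move=> ck kc; have ik := integrable_weight ck kc.
apply: le_trans (le_normr_Rintegral mOmega ik) _.
have imu := integrable_norm mu_int.
rewrite -RintegralZl//; apply: le_Rintegral => //.
- exact: integrable_norm.
- by have := integrableZl mOmega c imu; apply: eq_integrable => // x _.
by move=> x Ox; rewrite normrM mulrC ler_wpM2r// kc.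
Qed.

End weighted.

Section potential.
Variable R : realType.
Variables (Omega : set (space3 R)) (G : R) (mu : space3 R -> R).
Hypothesis Omega_open : open Omega.
Hypothesis G_gt0 : 0 < G.
Hypothesis mu_int : (leb3 R).-integrable Omega (EFin \o mu).

Definition potential (p : space3 R) : R :=
  \int[leb3 R]_(x in Omega) (G * mu x / norm3 (p - x)).

(** A quantitative form of [p] being outside the closure of [Omega], stated on
    [Omega] itself, where the integrals live. *)
Definition clearance (p : space3 R) (d : R) :=
  forall x, Omega x -> d <= norm3 (p - x).

Section at_point.
Variables (p : space3 R) (d : R).
Hypothesis d_gt0 : 0 < d.
Hypothesis pd : clearance p d.

Let n_gt0 x : Omega x -> 0 < norm3 (p - x).
Proof. by move=> Ox; apply: lt_le_trans (pd Ox). Qed.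

Let cvg_sub (x : space3 R) : p - y @[y --> x] --> p - x.
Proof. by apply: cvgB; [exact: cvg_cst|exact: cvg_id]. Qed.

Lemma newton_continuous x : Omega x ->
  {for x, continuous (fun y : space3 R => G / norm3 (p - y))}.
Proof.
move=> Ox; apply: cvgM; first exact: cvg_cst.
apply: cvgV; first exact: lt0r_neq0 (n_gt0 Ox).
by apply: cvg_norm3; exact: cvg_sub.
Qed.

Lemma newton_bound x : Omega x -> `|G / norm3 (p - x)| <= G / d.
Proof.
move=> Ox; rewrite ger0_norm ?divr_ge0 ?norm3_ge0 ?(ltW G_gt0)//.
by rewrite ler_wpM2l ?(ltW G_gt0)// lef_pV2 ?posrE ?n_gt0// pd.
Qed.

Lemma force_continuous h x : Omega x ->
  {for x, continuous
    (fun y : space3 R => G / norm3 (p - y) ^+ 3 * dot3 (p - y) h)}.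
Proof.
move=> Ox; apply: cvgM; last first.
  by apply: cvg_dot3; [exact: cvg_sub|exact: cvg_cst].
apply: cvgM; first exact: cvg_cst.
apply: cvgV; first by rewrite lt0r_neq0 ?exprn_gt0 ?n_gt0.
have cn : norm3 (p - y) @[y --> x] --> norm3 (p - x).
  by apply: cvg_norm3; exact: cvg_sub.
exact: (cvg_comp _ _ cn (@exprn_continuous R 3 (norm3 (p - x)))).
Qed.

Lemma force_bound h x : Omega x ->
  `|G / norm3 (p - x) ^+ 3 * dot3 (p - x) h| <= G / d ^+ 2 * norm3 h.
Proof.
move=> Ox; have n0 := n_gt0 Ox; have dn := pd Ox.
have cs : `|dot3 (p - x) h| <= norm3 (p - x) * norm3 h.
  rewrite ler_norml CauchySchwarz3 andbT lerNl.
  rewrite -[norm3 h]norm3N; apply: le_trans (CauchySchwarz3 _ _).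
  by rewrite /dot3/=; lra.
rewrite normrM ger0_norm ?divr_ge0 ?exprn_ge0 ?(ltW n0) ?(ltW G_gt0)//.
apply: (@le_trans _ _ (G / norm3 (p - x) ^+ 3 * (norm3 (p - x) * norm3 h))).
  by rewrite ler_wpM2l// divr_ge0 ?exprn_ge0 ?(ltW n0) ?(ltW G_gt0).
rewrite mulrA ler_wpM2r ?norm3_ge0//.
have -> : G / norm3 (p - x) ^+ 3 * norm3 (p - x) = G / norm3 (p - x) ^+ 2.
  by field; rewrite gt_eqF.
rewrite ler_wpM2l ?(ltW G_gt0)// lef_pV2 ?posrE ?exprn_gt0//.
by rewrite lerXn2r// nnegrE ltW.
Qed.

Lemma potential_weight :
  potential p = \int[leb3 R]_(x in Omega) (mu x * (G / norm3 (p - x))).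
Proof. by apply: eq_Rintegral => x _; rewrite mulrA (mulrC G). Qed.

(** The gravitational field is defined by three coordinate integrals; this
    collects them into the single integral that [potential_taylor] compares
    with the increment of the potential. *)
Lemma dot3_gravity h : dot3 (gravity G Omega mu p) h =
  - \int[leb3 R]_(x in Omega)
      (mu x * (G / norm3 (p - x) ^+ 3 * dot3 (p - x) h)).
Proof.
have mO : @measurable _ (borel3 R) Omega by exact: open3_measurable.
pose k e x := mu x * (G / norm3 (p - x) ^+ 3 * dot3 (p - x) e).
have ik e : (leb3 R).-integrable Omega (EFin \o k e).
  apply: (integrable_weight Omega_open mu_int (@force_continuous e)) => x.
  exact: force_bound.
pose e1 : space3 R := (1, 0, 0); pose e2 : space3 R := (0, 1, 0).
pose e3 : space3 R := (0, 0, 1).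
have -> : \int[leb3 R]_(x in Omega) (k h x) =
    \int[leb3 R]_(x in Omega) (h.1.1 * k e1 x + h.1.2 * k e2 x + h.2 * k e3 x).
  by apply: eq_Rintegral => x _; rewrite /k /dot3/=; ring.
have iZ (r : R) e : (leb3 R).-integrable Omega (EFin \o (fun x => r * k e x)).
  by have := integrableZl mO r (ik e); apply: eq_integrable.
rewrite !RintegralD// ?RintegralZl//; last first.
  by have := integrableD mO (iZ h.1.1 e1) (iZ h.1.2 e2); apply: eq_integrable.
rewrite /gravity /vintegral {1}/dot3 /=.
have E (e : space3 R) (c : space3 R -> R) : (forall x, c x = dot3 x e) ->
    \int[leb3 R]_(x in Omega) (G * mu x / norm3 (p - x) ^+ 3 * c (p - x)) =
    \int[leb3 R]_(x in Omega) (k e x).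
  by move=> ce; apply: eq_Rintegral => x _; rewrite ce /k; ring.
rewrite -(E e1 (fun x => x.1.1)); last by move=> x; rewrite /dot3/=; ring.
rewrite -(E e2 (fun x => x.1.2)); last by move=> x; rewrite /dot3/=; ring.
rewrite -(E e3 snd); last by move=> x; rewrite /dot3/=; ring.
by rewrite !mulNr -!opprD; congr (- (_ + _ + _)); rewrite mulrC.
Qed.

End at_point.

Lemma potential_le p (d : R) : 0 < d -> clearance p d ->
  potential p <= G / d * \int[leb3 R]_(x in Omega) `|mu x|.
Proof.
move=> d0 pd; rewrite potential_weight; apply: le_trans (ler_norm _) _.
apply: Rintegral_weight_le => // x Ox.
- exact: newton_continuous d0 pd _ Ox.
- exact: newton_bound.
Qed.

(** The gravitational field is the gradient of the potential, with a quadratic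
    remainder: integrate [inv_norm3_taylor] against [G * mu]. *)
Lemma potential_taylor p q (d : R) : 0 < d -> clearance p d -> clearance q d ->
  `|potential q - potential p - dot3 (gravity G Omega mu p) (q - p)| <=
    G * norm3 (q - p) ^+ 2 / d ^+ 3 * \int[leb3 R]_(x in Omega) `|mu x|.
Proof.
move=> d0 pd qd.
have mO : @measurable _ (borel3 R) Omega by exact: open3_measurable.
rewrite !potential_weight (dot3_gravity d0 pd) opprK.
have ip (r : space3 R) : clearance r d -> (leb3 R).-integrable Omega
    (EFin \o (fun x => mu x * (G / norm3 (r - x)))).
  move=> rd; apply: (integrable_weight Omega_open mu_int
    (fun x => @newton_continuous _ _ d0 rd x)) => x.
  exact: (newton_bound d0 rd).
have ik : (leb3 R).-integrable Omega (EFin \o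
    (fun x => mu x * (G / norm3 (p - x) ^+ 3 * dot3 (p - x) (q - p)))).
  apply: (integrable_weight Omega_open mu_int
    (fun x => @force_continuous _ _ d0 pd _ x)) => x.
  exact: (force_bound d0 pd).
rewrite -RintegralB ?ip// -RintegralD//; last first.
  by have := integrableB mO (ip _ qd) (ip _ pd); apply: eq_integrable.
rewrite (_ : \int[leb3 R]_(x in Omega) _ = \int[leb3 R]_(x in Omega)
   (mu x * (G / norm3 (q - x) - G / norm3 (p - x)
      + G / norm3 (p - x) ^+ 3 * dot3 (p - x) (q - p)))); last first.
  by apply: eq_Rintegral => x _; ring.
apply: Rintegral_weight_le => // x Ox.
  apply: cvgD; last exact: force_continuous d0 pd _ _ Ox.
  by apply: cvgB; [exact: newton_continuous d0 qd _ Ox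
                  |exact: newton_continuous d0 pd _ Ox].
have -> : G / norm3 (q - x) - G / norm3 (p - x)
      + G / norm3 (p - x) ^+ 3 * dot3 (p - x) (q - p) =
    G * ((norm3 (q - x))^-1 - (norm3 (p - x))^-1
      + dot3 (p - x) (q - x - (p - x)) / norm3 (p - x) ^+ 3).
  by rewrite opprB addrA subrK; ring.
have -> : q - p = q - x - (p - x) by rewrite opprB addrA subrK.
rewrite normrM (gtr0_norm G_gt0) -mulrA ler_wpM2l ?(ltW G_gt0)//.
exact: inv_norm3_taylor d0 (pd x Ox) (qd x Ox).
Qed.

End potential.

(** * Distance to the closure *)

Section distance.
Variable R : realType.
Implicit Types (A : set (space3 R)) (p q : space3 R).

(** One lower bound [d] serves for all points near [p], which is the uniformity
    that the Taylor estimate requires. *)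
Lemma clearance_near A p : ~ closure A p ->
  exists2 d : R, 0 < d & \forall q \near p, clearance A q d.
Proof.
move=> nAp.
have : nbhs p (~` closure A).
  apply: open_nbhs_nbhs; split=> //.
  by apply: closed_openC; exact: closed_closure.
move=> /nbhs_ballP[e /= e0 pe]; exists (e / 2); first by rewrite divr_gt0.
have : nbhs p (ball p (e / 2)) by apply: nbhsx_ballx; rewrite divr_gt0.
apply: filterS => q pq x Ax; rewrite leNgt; apply/negP => qx.
apply: (pe x); last exact: subset_closure.
rewrite (splitr e); apply: ball_triangle pq _.
by rewrite -ball_normE /=; apply: le_lt_trans qx; exact: normr_le_norm3.
Qed.

Lemma clearance_dist3 A p : clearance A p (dist3 p (closure A)).
Proof.
move=> x Ax; apply: ge_inf; last by exists x => //; exact: subset_closure.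
by exists 0 => _ [y _ <-]; exact: norm3_ge0.
Qed.

Lemma bounded_closure A : bounded_set A -> bounded_set (closure A).
Proof.
move=> [B [Breal AB]]; exists (B + 2); split; first by rewrite num_real.
move=> r Br y Ay.
have [z [Az yz]] := Ay _ (nbhsx_ballx y _ ltr01).
have zB : `|z| <= B + 1 by apply: AB => //; rewrite ltrDl.
rewrite -ball_normE/= in yz.
rewrite -(subrK z y); apply: le_trans (ler_normD _ _) _.
lra.
Qed.

Lemma bounded_dist3 A (T : Type) (J : set T) (u : T -> space3 R) (c : R) :
  A !=set0 -> bounded_set A ->
  (forall t, J t -> dist3 (u t) (closure A) <= c) -> [bounded u t | t in J].
Proof.
move=> [a Aa] /bounded_closure[B [Breal AB]] uc.
exists (c + B + 2); split; first by rewrite num_real.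
move=> r cr t Jt.
have hi : has_inf [set norm3 (u t - y) | y in closure A].
  split; first by exists (norm3 (u t - a)), a => //; exact: subset_closure.
  by exists 0 => _ [y _ <-]; exact: norm3_ge0.
have [_ [y Ay <-] yd] := inf_adherent ltr01 hi.
have yB : `|y| <= B + 1 by apply: AB => //; rewrite ltrDl.
have utc := uc t Jt; rewrite /dist3 in utc.
have uy := normr_le_norm3 (u t - y).
rewrite /= -(subrK y (u t)); apply: le_trans (ler_normD _ _) _.
lra.
Qed.

End distance.

(** * Functions with vanishing difference quotients *)

Section zero_derivative.
Variable R : realType.

#[local] Instance within_dnbhs_filter (V : topologicalType) (I : set V)
    (t : V) : Filter (within I t^').
Proof. exact: within_filter. Qed.

Lemma near_dnbhs_neq (V : topologicalType) (I : set V) (t : V) :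
  \forall s \near within I t^', s != t.
Proof. exact: cvg_within (nbhs_dnbhs_neq t). Qed.

Lemma cvg_near_eq (T : Type) (V : topologicalType) (F : set_system T)
    (FF : Filter F) (f g : T -> V) (l : V) :
  (\forall s \near F, f s = g s) -> f @ F --> l -> g @ F --> l.
Proof. by move=> fg fl U /fl; apply: filterS2 fg => s /= ->. Qed.

Lemma cvg_sub_within (I : set R) (t : R) :
  (fun s : R => s - t) @ within I t^' --> (0 : R).
Proof.
do 2!apply: cvg_within_filter.
have : (fun s : R => s - t) @ t --> t - t.
  by apply: cvgB => //; exact: cvg_cst.
by rewrite subrr.
Qed.

Lemma cvg_quotient_cvg (V : normedModType R) (I : set R) (f : R -> V) (d : V)
    (t : R) :
  (fun s => (s - t)^-1 *: (f s - f t)) @ within I t^' --> d ->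
  f @ within I t^' --> f t.
Proof.
move=> fd.
have st := cvg_sub_within I t.
have lim : (fun s : R => (s - t) *: ((s - t)^-1 *: (f s - f t)) + f t)
    @ within I t^' --> f t.
  rewrite -[X in _ --> X]add0r -(scale0r d).
  by apply: cvgD; [exact: cvgZ|exact: cvg_cst].
apply: cvg_near_eq lim; apply: filterS (near_dnbhs_neq I t) => s sneq.
by rewrite /= scalerA divff ?subr_eq0// scale1r subrK.
Qed.

(** The mean value theorem on [[0, t]]: at interior points the quotients
    restricted to the time interval are the two-sided ones, and at the
    endpoints their convergence gives the continuity of [e] on [[0, t]]. *)
Lemma zero_quotient_constant (T : \bar R) (e : R -> R) :
  (forall t, time_interval T t ->
    (fun s => (s - t)^-1 * (e s - e t)) @ within (time_interval T) t^'
      --> (0 : R)) ->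
  forall t, time_interval T t -> e t = e 0.
Proof.
move=> de t [t0 tT]; have [->//|tneq0] := eqVneq t 0.
have {tneq0} t0' : 0 < t by rewrite lt_neqAle eq_sym tneq0.
have sub : `[0, t] `<=` time_interval T.
  move=> x /=; rewrite in_itv/= => /andP[x0 xt]; split=> //.
  by apply: le_lt_trans tT; rewrite lee_fin.
have [||c _ /eqP] := @MVT R e (fun=> 0) 0 t t0'; last first.
- by rewrite mul0r subr_eq0 => /eqP.
- apply/subspace_continuousP => x xI U Ue.
  have h : \forall s \near (x : R), s != x -> time_interval T s -> U (e s).
    exact: (cvg_quotient_cvg (V := R^o) (de x (sub x xI)) Ue).
  apply: filterS h => s h sI.
  have [->|sx] := eqVneq s x; first exact: (nbhs_singleton Ue).
  exact: h sx (sub _ sI).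
move=> x xI.
have xT : time_interval T x by apply: sub; exact: subset_itv_oo_cc xI.
have IT : nbhs x (time_interval T).
  have : nbhs x `]0, t[%classic.
    by apply: open_nbhs_nbhs; split=> //; exact: interval_open.
  by apply: filterS => y /subset_itv_oo_cc/sub.
have c : h^-1 *: (e (h *: 1 + x) - e x) @[h --> (0 : R)^'] --> (0 : R).
  have shift : h *: 1 + x @[h --> (0 : R)] --> x.
    rewrite -[X in _ --> X]add0r -{2}[0](scale0r (1 : R)).
    by apply: cvgD; [apply: cvgZr_tmp|exact: cvg_cst].
  move=> U /(de x xT) h0.
  have {}h0 : \forall s \near x, s != x -> U ((s - x)^-1 * (e s - e x)).
    by apply: filterS2 IT h0 => s sT h0 sx; exact: h0.
  have h1 : \forall h \near (0 : R), h != 0 ->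
      U (h^-1 *: (e (h *: 1 + x) - e x)).
    have h2 : \forall h \near (0 : R), h *: 1 + x != x ->
      U ((h *: 1 + x - x)^-1 * (e (h *: 1 + x) - e x)) := shift _ h0.
    apply: filterS h2 => h + hneq.
    by rewrite addrK /GRing.scale/= mulr1; apply; rewrite -subr_eq0 addrK.
  exact: h1.
split; first by apply/cvg_ex; exists 0.
exact: cvg_lim.
Qed.

End zero_derivative.

(** * Conservation of energy *)

Section energy.
Variable R : realType.
Variables (Omega : set (space3 R)) (G : R) (mu : space3 R -> R).
Hypothesis Omega_open : open Omega.
Hypothesis G_gt0 : 0 < G.
Hypothesis mu_int : (leb3 R).-integrable Omega (EFin \o mu).

Definition energy (u v : R -> space3 R) (t : R) : R :=
  dot3 (v t) (v t) / 2 - potential Omega G mu (u t).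

(** The quotient splits into [A], whose kinetic and potential parts cancel in
    the limit because the acceleration is the gradient of the potential, and
    the Taylor remainder of the potential, which is quadratic in the
    displacement and so contributes at most [B], of order [`|s - t|]. *)
Lemma energy_quotient_cvg0 (I : set R) (u v : R -> space3 R) (t : R) :
  ~ closure Omega (u t) ->
  (fun s => (s - t)^-1 *: (u s - u t)) @ within I t^' --> v t ->
  (fun s => (s - t)^-1 *: (v s - v t)) @ within I t^'
    --> gravity G Omega mu (u t) ->
  (fun s => (s - t)^-1 * (energy u v s - energy u v t)) @ within I t^'
    --> (0 : R).
Proof.
move=> nO du dv; set g := gravity _ _ _ _ in dv.
pose K := \int[leb3 R]_(x in Omega) `|mu x|.
have [d d0 near_d] := clearance_near nO.
have pd : clearance Omega (u t) d by exact: nbhs_singleton near_d.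
have cu := cvg_quotient_cvg du; have cv := cvg_quotient_cvg dv.
pose Qu s := (s - t)^-1 *: (u s - u t); pose Qv s := (s - t)^-1 *: (v s - v t).
pose A s := dot3 (Qv s) (v s + v t) / 2 - dot3 g (Qu s).
pose B s := G / d ^+ 3 * K * (`|s - t| * dot3 (Qu s) (Qu s)).
have st := cvg_sub_within I t.
have A0 : A @ within I t^' --> (0 : R).
  have -> : 0 = dot3 g (v t + v t) / 2 - dot3 g (v t) by rewrite /dot3/=; field.
  apply: cvgB; last by apply: cvg_dot3; [exact: cvg_cst|exact: du].
  apply: cvgM; last exact: cvg_cst.
  by apply: cvg_dot3; [exact: dv|apply: cvgD; [exact: cv|exact: cvg_cst]].
have B0 : B @ within I t^' --> (0 : R).
  have -> : 0 = G / d ^+ 3 * K * (`|0 : R| * dot3 (v t) (v t)).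
    by rewrite normr0 mul0r mulr0.
  apply: cvgM; first exact: cvg_cst.
  apply: cvgM; first exact: cvg_norm.
  by apply: cvg_dot3; exact: du.
have AB : (fun s => `|A s| + B s) @ within I t^' --> (0 : R).
  have -> : 0 = `|0 : R| + 0 by rewrite normr0 addr0.
  by apply: cvgD => //; exact: cvg_norm.
have AB' : (fun s => - (`|A s| + B s)) @ within I t^' --> (0 : R).
  by rewrite -oppr0; exact: cvgN.
apply: (squeeze_cvgr _ AB' AB).
apply: filterS2 (near_dnbhs_neq I t) (cu _ near_d) => s sneq qd.
rewrite -ler_norml.
have := potential_taylor Omega_open G_gt0 mu_int d0 pd qd.
rewrite -/g -/K; set r := _ - dot3 g _ => rle.
have st0 : s - t != 0 by rewrite subr_eq0.
have -> : (s - t)^-1 * (energy u v s - energy u v t) = A s - (s - t)^-1 * r.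
  rewrite /energy /A /r /Qu /Qv dot3Zr [dot3 (_ *: _) _]dot3C dot3Zr.
  by rewrite /dot3/=; field.
apply: (le_trans (ler_normB _ _)); rewrite lerD2l.
have -> : B s = `|s - t|^-1 * (G * norm3 (u s - u t) ^+ 2 / d ^+ 3 * K).
  rewrite /B /Qu dot3Zr dot3C dot3Zr -sqr_norm3 mulrA -expr2 exprVn.
  rewrite -[(s - t) ^+ 2]real_normK ?num_real//.
  by field; rewrite !gt_eqF//= normr_gt0.
by rewrite normrM normfV ler_wpM2l// invr_ge0.
Qed.

End energy.

Theorem theorem3p1 (R : realType) (Omega : set (space3 R)) (G M : R)
    (mu : space3 R -> R) (u0 v0 : space3 R) (Tmax : \bar R) (u : R -> space3 R)
    (Omega_neq0 : Omega !=set0)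
    (Omega_bounded : bounded_set Omega)
    (Omega_open : open Omega)
    (G_gt0 : 0 < G)
    (mu_L1 : (leb3 R).-integrable Omega (EFin \o mu))
    (mu_ge0 : {ae leb3 R, forall x, Omega x -> 0 <= mu x})
    (M_def : M = \int[leb3 R]_(x in Omega) mu x)
    (M_gt0 : 0 < M)
    (u0_out : ~ closure Omega u0)
    (v0_small : norm3 v0 ^+ 2 <
       2 * \int[leb3 R]_(x in Omega) (G * mu x / norm3 (u0 - x)))
    (u_max : is_maximal_solution G Omega mu u0 v0 Tmax u) :
  [bounded u t | t in time_interval Tmax] /\
  forall t, time_interval Tmax t ->
    dist3 (u t) (closure Omega) <=
      2 * G * M /
      (\int[leb3 R]_(x in Omega) (2 * G * mu x / norm3 (u0 - x))
       - norm3 v0 ^+ 2).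
Proof.
have mO : @measurable _ (borel3 R) Omega by exact: open3_measurable.
(* The estimates for the potential are in terms of this integral. *)
have MK : \int[leb3 R]_(x in Omega) `|mu x| = M.
  rewrite M_def /Rintegral; congr fine; apply: ae_eq_integral => //.
  - by have /(measurable_int _) := integrable_norm mu_L1.
  - exact: measurable_int mu_L1.
  - apply: negligibleS mu_ge0 => x /= neq mux; apply: neq => Ox.
    by rewrite ger0_norm ?mux.
have [d0 d0_gt0 /nbhs_singleton u0_clear] := clearance_near u0_out.
have -> : \int[leb3 R]_(x in Omega) (2 * G * mu x / norm3 (u0 - x)) =
    2 * potential Omega G mu u0.
  rewrite /potential -RintegralZl//.
    by apply: eq_Rintegral => x _; rewrite !mulrA.
  have := integrable_weight Omega_open mu_L1
    (fun x => @newton_continuous _ _ _ _ _ d0_gt0 u0_clear x)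
    (newton_bound G_gt0 d0_gt0 u0_clear).
  by apply: eq_integrable => // x _ /=; rewrite mulrA (mulrC G).
rewrite -/(potential Omega G mu u0) in v0_small.
set D := _ - norm3 v0 ^+ 2.
have D_gt0 : 0 < D by rewrite subr_gt0.
case: u_max => -[T_gt0 [v [a [du dv _ [u00 v00] eqn]]]] _.
have conserved t : time_interval Tmax t -> energy Omega G mu u v t = - D / 2.
  move=> tT; rewrite (@zero_quotient_constant _ Tmax (energy Omega G mu u v))//.
    by rewrite /energy u00 v00 -sqr_norm3 /D; field.
  move=> s sT; have [nO as_] := eqn s sT.
  apply: energy_quotient_cvg0 => //; first exact: du.
  by rewrite -as_; exact: dv.
have dist_le t : time_interval Tmax t ->
    dist3 (u t) (closure Omega) <= 2 * G * M / D.
  (* At distance [0] the potential estimate would divide by zero, but the bound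
     is then trivial. *)
  move=> tT; have [dle|dgt] := leP (dist3 (u t) (closure Omega)) 0.
    by apply: le_trans dle _; rewrite ltW// divr_gt0// !mulr_gt0.
  have := potential_le Omega_open G_gt0 mu_L1 dgt (@clearance_dist3 _ _ _).
  rewrite MK => pot_le.
  have kin_ge0 : 0 <= dot3 (v t) (v t) by rewrite -sqr_norm3 sqr_ge0.
  have := conserved t tT; rewrite /energy => Et.
  have : D / 2 <= G / dist3 (u t) (closure Omega) * M by lra.
  rewrite mulrAC ler_pdivlMr// ler_pdivlMr//; lra.
by split=> //; exact: bounded_dist3 Omega_neq0 Omega_bounded dist_le.
Qed.
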